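(* Let $(\mathcal{A},[\cdot,\cdot]_{\mathcal{A}},a_{\mathcal{A}},\mathcal{B})$ be a Rota-Baxter Lie algebroid over a manifold $M$, and let $A=\ker(a_{\mathcal{A}})$. Define $\rhd_A$ on $\Gamma(A)$ by $$u\rhd_A v:=[\mathcal{B}(u),v]_{\mathcal{A}},\qquad \forall u,v\in\Gamma(\ker(a_{\mathcal{A}})).$$ Then $(A,[\cdot,\cdot]_{\mathcal{A}},\rhd_A,a_{\mathcal{A}}\circ\mathcal{B})$ is a post-Lie algebroid.
   Context: A Lie algebroid structure on a vector bundle $\mathcal{A}\to M$ is a Lie bracket $[\cdot,\cdot]_{\mathcal{A}}$ on $\Gamma(\mathcal{A})$ and a vector bundle morphism (anchor) $a_{\mathcal{A}}:\mathcal{A}\to TM$ with $[x,fy]_{\mathcal{A}}=f[x,y]_{\mathcal{A}}+a_{\mathcal{A}}(x)(f)y$ for $x,y\in\Gamma(\mathcal{A})$, $f\in C^\infty(M)$. It is transitive if $a_{\mathcal{A}}$ is surjective. A Rota-Baxter operator of weight $\lambda$ on a transitive Lie algebroid is a vector bundle map $\mathcal{B}:\ker(a_{\mathcal{A}})\to\mathcal{A}$ covering the identity of $M$ such that $[\mathcal{B}(u),\mathcal{B}(v)]_{\mathcal{A}}=\mathcal{B}([\mathcal{B}(u),v]_{\mathcal{A}})+\mathcal{B}([u,\mathcal{B}(v)]_{\mathcal{A}})+\lambda\mathcal{B}([u,v]_{\mathcal{A}})$ for all $u,v\in\Gamma(\ker(a_{\mathcal{A}}))$. A Rota-Baxter Lie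 algebroid is a (transitive) Lie algebroid equipped with a Rota-Baxter operator of weight $1$. A post-Lie algebra $(\mathfrak{g},[\cdot,\cdot]_{\mathfrak{g}},\rhd)$ is a Lie algebra with a bilinear product $\rhd$ such that $u\rhd[v,w]_{\mathfrak{g}}=[u\rhd v,w]_{\mathfrak{g}}+[v,u\rhd w]_{\mathfrak{g}}$ and $[u,v]_{\mathfrak{g}}\rhd w=a_\rhd(u,v,w)-a_\rhd(v,u,w)$, where $a_\rhd(u,v,w):=u\rhd(v\rhd w)-(u\rhd v)\rhd w$. A post-Lie algebroid $(A,[\cdot,\cdot]_A,\rhd_A,a_A)$ is a vector bundle $A\to M$ with a $C^\infty(M)$-linear Lie algebra structure $[\cdot,\cdot]_A$ on $\Gamma(A)$, a bilinear operation $\rhd_A$ on $\Gamma(A)$ and a vector bundle morphism $a_A:A\to TM$ such that $(\Gamma(A),[\cdot,\cdot]_A,\rhd_A)$ is a post-Lie algebra and, for all $f\in C^\infty(M)$, $u,v\in\Gamma(A)$: (i) $u\rhd_A(fv)=f(u\rhd_A v)+a_A(u)(f)v$; (ii) $(fu)\rhd_A v=f(u\rhd_A v)$. *)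

(* Defs.v *)
From HB Require Import structures.
From mathcomp Require Import all_boot all_order all_algebra.
From mathcomp Require Import all_classical all_reals all_analysis.
Set Implicit Arguments.
Unset Strict Implicit.
Unset Printing Implicit Defensive.
Import Order.TTheory GRing.Theory Num.Theory.
Import numFieldNormedType.Exports.
Local Open Scope classical_set_scope.
Local Open Scope ring_scope.

Section SmoothEuclidean.
Variables (R : realType) (n : nat).
Implicit Types (W : set 'rV[R]_n) (f g : 'rV[R]_n -> R).

(* W is meant to be open.  f is C^(k+1) on W when it is Frechet differentiable
   at every point of W and its partial derivatives are C^k on W; continuity of
   f is then automatic (Ck_onS). *)
Fixpoint Ck_on (k : nat) W f : Prop :=
  if k is k'.+1 then
    (forall x, W x -> differentiable f x) /\
    (forall i : 'I_n, Ck_on k' W ('D_(delta_mx 0 i) f))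
  else forall x, W x -> {for x, continuous f}.

Definition Cinf_on W f : Prop := forall k, Ck_on k W f.

Lemma differentiable_near_eq f g x :
  (\near x, f x = g x) -> differentiable f x -> differentiable g x.
Proof.
move=> fg df.
have hx : f x = g x := nbhs_singleton fg.
suff h : g \o shift x = cst (g x) + ('d f x : _ -> _) +o_ 0 id.
  have e := diff_unique (diff_continuous df) h.
  apply/diff_locallyP; rewrite e; split => //; exact: diff_continuous.
apply/eqaddoP => _ /posnumP[e].
have /diff_locally/eqaddoP H := df; have {}H := H e%:num [elaborate gt0 e].
have fg0 : \forall y \near 0, f (y + x) = g (y + x).
  by move: fg; rewrite (near_shift 0)/=; apply: filterS => y /=; rewrite subr0.
by apply: filterS2 fg0 H => y fgy; rewrite !fctE /= -fgy -hx.
Qed.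

Lemma Ck_onW k W W' f : W' `<=` W -> Ck_on k W f -> Ck_on k W' f.
Proof.
move=> sW; elim: k f => [|k IH] f; first by move=> H x /sW/H.
by case=> H1 H2; split=> [x /sW/H1//|i]; exact/IH/H2.
Qed.

Lemma Ck_on_eq k W f g : open W -> {in W, f =1 g} -> Ck_on k W f -> Ck_on k W g.
Proof.
move=> oW; elim: k f g => [|k IH] f g fg.
  move=> H x Wx; have nx : \near x, f x = g x.
    by near=> y; apply: fg; rewrite inE; near: y; exact: open_nbhs_nbhs.
  have Hx := H x Wx.
  rewrite /prop_for /continuous_at -(nbhs_singleton nx).
apply: cvg_trans Hx; apply: (@near_eq_cvg _ _ (nbhs x) _ f g); exact: nx.
have nx x : W x -> \near x, f x = g x.
  by move=> Wx; near=> y; apply: fg; rewrite inE; near: y; exact: open_nbhs_nbhs.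
case=> H1 H2; split=> [x Wx|i].
  by apply: differentiable_near_eq (nx _ Wx) _; exact: H1.
apply: (IH _ _ _ (H2 i)) => x; rewrite inE => Wx.
by apply: near_eq_derive; exact: nx.
Unshelve. all: by end_near. Qed.

Lemma Ck_on_local k W f :
  (forall x, W x -> exists2 N, open N /\ N x & Ck_on k (W `&` N) f) ->
  Ck_on k W f.
Proof.
elim: k f => [|k IH] f H.
  by move=> x Wx; have [N [_ Nx] H1] := H x Wx; exact: H1.
split=> [x Wx|i]; first by have [N [_ Nx] [H1 _]] := H x Wx; exact: H1.
by apply: IH => x /H [N oN [_ H2]]; exists N => //; exact: H2.
Qed.

Lemma Ck_onS k W f : Ck_on k.+1 W f -> Ck_on k W f.
Proof.
elim: k f => [|k IH] f.
  by case=> H _ x /H /differentiable_continuous.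
by case=> H1 H2; split => // i; exact/IH/H2.
Qed.

Lemma Ck_on0 k W : Ck_on k W (fun=> 0).
Proof.
elim: k => [|k IH]; first by move=> x _; exact: cst_continuous.
split=> [x _|i]; first exact: differentiable_cst.
rewrite (_ : 'D__ _ = fun=> 0) //; apply/funext => x; exact: derive_cst.
Qed.

Lemma Ck_on_cst k W c : Ck_on k W (fun=> c).
Proof.
elim: k => [|k IH]; first by move=> x _; exact: cst_continuous.
split=> [x _|i]; first exact: differentiable_cst.
rewrite (_ : 'D__ _ = fun=> 0); first exact: Ck_on0.
by apply/funext => x; exact: derive_cst.
Qed.

Lemma Ck_onD k W f g : open W ->
  Ck_on k W f -> Ck_on k W g -> Ck_on k W (fun x => f x + g x).
Proof.
move=> oW; elim: k f g => [|k IH] f g.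
  by move=> Hf Hg x Wx; apply: continuousD; [exact: Hf|exact: Hg].
move=> [f1 f2] [g1 g2]; split=> [x Wx|i].
  by apply: differentiableD; [exact: f1|exact: g1].
apply: (Ck_on_eq oW _ (IH _ _ (f2 i) (g2 i))) => x; rewrite inE => Wx.
rewrite [RHS](@deriveD _ _ _ f g) //; apply: diff_derivable; [exact: f1|exact: g1].
Qed.

Lemma Ck_onM k W f g : open W ->
  Ck_on k W f -> Ck_on k W g -> Ck_on k W (fun x => f x * g x).
Proof.
move=> oW; elim: k f g => [|k IH] f g.
  by move=> Hf Hg x Wx; apply: continuousM; [exact: Hf|exact: Hg].
move=> Hf Hg; have [f1 f2] := Hf; have [g1 g2] := Hg; split=> [x Wx|i].
  by apply: differentiableM; [exact: f1|exact: g1].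
have H := Ck_onD oW (IH _ _ (Ck_onS Hf) (g2 i)) (IH _ _ (Ck_onS Hg) (f2 i)).
apply: (Ck_on_eq oW _ H) => x; rewrite inE => Wx.
by rewrite [RHS](@deriveM _ _ f g) //; apply: diff_derivable; [exact: f1|exact: g1].
Qed.

Lemma Ck_onV k W f : open W -> (forall x, W x -> f x != 0) ->
  Ck_on k W f -> Ck_on k W (fun x => (f x)^-1).
Proof.
move=> oW f0; elim: k => [|k IH].
  by move=> Hf x Wx; apply: continuousV; [exact: f0|exact: Hf].
move=> Hf; have [f1 f2] := Hf; split=> [x Wx|i].
  by apply: differentiableV; [exact: f1|exact: f0].
have V := IH (Ck_onS Hf).
have H := Ck_onM oW (Ck_on_cst k W (-1)) (Ck_onM oW (Ck_onM oW V V) (f2 i)).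
apply: (Ck_on_eq oW _ H) => x; rewrite inE => Wx.
rewrite [RHS]deriveV //; [|exact: f0|exact/diff_derivable/f1].
by rewrite mulN1r scaleNr -expr2 exprVn.
Qed.

End SmoothEuclidean.

Section CompEuclidean.
Variables (R : realType) (n m : nat).

Lemma row_sum_coord (T : Type) (g : T -> 'rV[R]_m) :
  g = \sum_(l < m) (fun x => g x 0 l *: delta_mx 0 l : 'rV[R]_m).
Proof.
by apply/funext => x; rewrite fct_sumE [LHS]row_sum_delta.
Qed.

Lemma differentiable_rV (g : 'rV[R]_n -> 'rV[R]_m) x :
  (forall l, differentiable (fun x => g x 0 l : R) x) -> differentiable g x.
Proof.
move=> H; rewrite (row_sum_coord g); apply: differentiable_sum => l.
exact: differentiableZl.
Qed.

Lemma continuous_rV (T : topologicalType) (g : T -> 'rV[R]_m) x :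
  (forall l, {for x, continuous (fun x => g x 0 l : R)}) -> {for x, continuous g}.
Proof.
move=> H; rewrite (row_sum_coord g).
elim/big_ind : _ => [|f1 f2 h1 h2|l _].
- exact: cvg_cst.
- exact: cvgD.
- apply: cvgZr_tmp; exact: H.
Qed.

Lemma derive_comp_rV (f : 'rV[R]_m -> R) (g : 'rV[R]_n -> 'rV[R]_m) x v :
  differentiable f (g x) -> differentiable g x ->
  'D_v (f \o g) x =
  \sum_(l < m) 'D_(delta_mx 0 l) f (g x) * 'D_v (fun y => g y 0 l) x.
Proof.
move=> df dg; rewrite deriveE; last exact: differentiable_comp.
rewrite diff_comp //= [X in 'd f _ X]row_sum_delta linear_sum.
apply: eq_bigr => l _; rewrite linearZ /= deriveE // mulrC; congr (_ * _).
rewrite -deriveE // derive_mx ?mxE //; exact: diff_derivable.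
Qed.

Lemma Ck_on_sum (I : Type) (r : seq I) k (W : set 'rV[R]_n) (F : I -> 'rV[R]_n -> R) :
  open W -> (forall i, Ck_on k W (F i)) -> Ck_on k W (fun x => \sum_(i <- r) F i x).
Proof.
move=> oW H; elim: r => [|i r IH].
  apply: (Ck_on_eq oW _ (Ck_on0 k W)) => x _; by rewrite big_nil.
apply: (Ck_on_eq oW _ (Ck_onD oW (H i) IH)) => x _; by rewrite big_cons.
Qed.

Lemma Ck_on_comp k (W : set 'rV[R]_n) (V : set 'rV[R]_m)
  (f : 'rV[R]_m -> R) (g : 'rV[R]_n -> 'rV[R]_m) :
  open W -> (forall x, W x -> V (g x)) ->
  Ck_on k V f -> (forall l, Ck_on k W (fun x => g x 0 l)) ->
  Ck_on k W (f \o g).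
Proof.
move=> oW gWV; elim: k f => [|k IH] f Hf Hg.
  move=> x Wx; apply: continuous_comp; last exact/Hf/gWV.
  by apply: continuous_rV => l; exact: Hg.
have dg x : W x -> differentiable g x.
  by move=> Wx; apply: differentiable_rV => l; exact: (Hg l).1.
have [f1 f2] := Hf; split=> [x Wx|i].
  by apply: differentiable_comp; [exact: dg|exact/f1/gWV].
have H : Ck_on k W (fun x => \sum_(l < m) 'D_(delta_mx 0 l) f (g x) *
    'D_(delta_mx 0 i) (fun y => g y 0 l) x).
  apply: Ck_on_sum => // l; apply: Ck_onM => //; last exact: (Hg l).2.
  by apply: (IH _ (f2 l)) => j; exact/Ck_onS/Hg.
apply: (Ck_on_eq oW _ H) => x; rewrite inE => Wx.
by rewrite derive_comp_rV //; [exact/f1/gWV|exact: dg].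
Qed.

End CompEuclidean.

(* A Hausdorff second countable space with a smooth atlas of dimension n.  The
   charts and their inverses are total functions, meaningful only on chart_dom i
   and on its image. *)
Record manifold (R : realType) (n : nat) := Manifold {
  manifold_space :> topologicalType;
  manifold_hausdorff : hausdorff_space manifold_space;
  manifold_second_countable : @second_countable manifold_space;
  chart_idx : Type;
  chart_dom : chart_idx -> set manifold_space;
  chart : chart_idx -> manifold_space -> 'rV[R]_n;
  chart_inv : chart_idx -> 'rV[R]_n -> manifold_space;
  chart_dom_open : forall i, open (chart_dom i);
  chart_cod_open : forall i, open (chart i @` chart_dom i);
  chartK : forall i p, chart_dom i p -> chart_inv i (chart i p) = p;
  chart_continuous : forall i p, chart_dom i p -> {for p, continuous (chart i)};
  chart_inv_continuous : forall i p, chart_dom i p ->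
    {for chart i p, continuous (chart_inv i)};
  chart_cover : forall p, exists i, chart_dom i p;
  chart_smooth : forall i j (l : 'I_n),
    Cinf_on (chart i @` (chart_dom i `&` chart_dom j))
            (fun x => chart j (chart_inv i x) 0 l)
}.

Section SmoothManifold.
Variables (R : realType) (n : nat) (M : manifold R n).
Implicit Types (W : set M) (f g : M -> R).

(* Smoothness in all charts; W is meant to be open. *)
Definition smooth_on W f : Prop :=
  forall i, Cinf_on (chart i @` (chart_dom i `&` W)) (f \o @chart_inv _ _ M i).

Lemma chart_img_open i W : open W -> open (chart i @` (chart_dom i `&` W)).
Proof.
move=> oW; rewrite openE => _ [p [ip Wp] <-]; rewrite /interior.
have H1 : nbhs (chart i p) (chart i @` chart_dom i).
  by apply: open_nbhs_nbhs; split; [exact: chart_cod_open|exists p].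
have H2 : nbhs (chart i p) (chart_inv i @^-1` W).
  have := chart_inv_continuous ip; apply; rewrite chartK //.
  exact: open_nbhs_nbhs.
apply: filterS2 H1 H2 => _ [q iq <-] /=; rewrite chartK // => Wq.
by exists q.
Qed.

Lemma smooth_onW W W' f : W' `<=` W -> smooth_on W f -> smooth_on W' f.
Proof.
move=> sW H i k; apply: Ck_onW (H i k); apply: image_subset.
exact: setIS.
Qed.

Lemma smooth_on_eq W f g : open W -> (forall p, W p -> f p = g p) ->
  smooth_on W f -> smooth_on W g.
Proof.
move=> oW fg H i k; apply: Ck_on_eq (H i k); first exact: chart_img_open.
by move=> x; rewrite inE => -[p [ip Wp] <-] /=; rewrite chartK // fg.
Qed.

Lemma smooth_on_local W f : open W ->
  (forall p, W p -> exists2 N : set M, open N /\ N p & smooth_on (W `&` N) f) ->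
  smooth_on W f.
Proof.
move=> oW H i k; apply: Ck_on_local => _ [p [ip Wp] <-].
have [N [oN Np] Hf] := H p Wp.
exists (chart i @` (chart_dom i `&` N)).
  by split; [exact: chart_img_open|exists p].
apply: Ck_onW (Hf i k) => _ [[q [iq Wq] <-] [q' [iq' Nq'] e]].
by exists q => //; split=> //; split=> //; rewrite -(chartK iq) -e chartK.
Qed.

Lemma smooth_on_cst W c : smooth_on W (fun=> c).
Proof. by move=> i k; exact: Ck_on_cst. Qed.

Lemma smooth_onD W f g : open W -> smooth_on W f -> smooth_on W g ->
  smooth_on W (fun p => f p + g p).
Proof.
by move=> oW Hf Hg i k; apply: (Ck_onD _ (Hf i k) (Hg i k)); exact: chart_img_open.
Qed.

Lemma smooth_onM W f g : open W -> smooth_on W f -> smooth_on W g ->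
  smooth_on W (fun p => f p * g p).
Proof.
by move=> oW Hf Hg i k; apply: (Ck_onM _ (Hf i k) (Hg i k)); exact: chart_img_open.
Qed.

Lemma smooth_onV W f : open W -> (forall p, W p -> f p != 0) ->
  smooth_on W f -> smooth_on W (fun p => (f p)^-1).
Proof.
move=> oW f0 Hf i k; apply: (Ck_onV _ _ (Hf i k)); first exact: chart_img_open.
by move=> _ [p [ip Wp] <-] /=; rewrite chartK // f0.
Qed.

Lemma smooth_on_sum (I : Type) (s : seq I) (P : pred I) W (F : I -> M -> R) :
  open W -> (forall i, P i -> smooth_on W (F i)) ->
  smooth_on W (fun p => \sum_(i <- s | P i) F i p).
Proof.
move=> oW H; elim: s => [|i s IH].
  by apply: (smooth_on_eq oW _ (smooth_on_cst W 0)) => p _; rewrite big_nil.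
case Pi : (P i).
  apply: (smooth_on_eq oW _ (smooth_onD oW (H _ Pi) IH)) => p _.
  by rewrite big_cons Pi.
by apply: (smooth_on_eq oW _ IH) => p _; rewrite big_cons Pi.
Qed.

Lemma smooth_on_prod (I : Type) (s : seq I) (P : pred I) W (F : I -> M -> R) :
  open W -> (forall i, P i -> smooth_on W (F i)) ->
  smooth_on W (fun p => \prod_(i <- s | P i) F i p).
Proof.
move=> oW H; elim: s => [|i s IH].
  by apply: (smooth_on_eq oW _ (smooth_on_cst W 1)) => p _; rewrite big_nil.
case Pi : (P i).
  apply: (smooth_on_eq oW _ (smooth_onM oW (H _ Pi) IH)) => p _.
  by rewrite big_cons Pi.
by apply: (smooth_on_eq oW _ IH) => p _; rewrite big_cons Pi.
Qed.

Lemma smooth_on_continuous W f p : open W -> smooth_on W f -> W p ->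
  {for p, continuous f}.
Proof.
move=> oW Hf Wp; have [i ip] := chart_cover p.
have c : {for p, continuous ((f \o @chart_inv _ _ M i) \o chart i)}.
  apply: continuous_comp; first exact: chart_continuous.
  by apply: (Hf i 0%N); exists p.
rewrite /prop_for /continuous_at in c *.
rewrite /= chartK // in c.
apply: cvg_trans c; apply: (@near_eq_cvg _ _ (nbhs p)).
have : nbhs p (chart_dom i) by apply: open_nbhs_nbhs; split => //; exact: chart_dom_open.
by apply: filterS => q iq /=; rewrite chartK.
Qed.

Lemma smooth_on_chart i W (g : 'rV[R]_n -> R) : open W ->
  Cinf_on (chart i @` (chart_dom i `&` W)) g ->
  smooth_on (chart_dom i `&` W) (g \o @chart _ _ M i).
Proof.
move=> oW Hg j k.
have oiW : open (chart_dom i `&` W) by apply: openI => //; exact: chart_dom_open.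
have H := @Ck_on_comp R n n k (chart j @` (chart_dom j `&` (chart_dom i `&` W))) _
  g (fun x => chart i (@chart_inv _ _ M j x)) (chart_img_open (i:=j) oiW) _ (Hg k).
apply: H => [_ [q [jq [iq Wq]] <-]|l]; first by exists q; rewrite ?chartK.
apply: Ck_onW (chart_smooth (m:=M) j i l k) => _ [q [jq [iq Wq]] <-].
by exists q.
Qed.

Definition smooth_mx a b W (A : M -> 'M[R]_(a, b)) : Prop :=
  forall k l, smooth_on W (fun p => A p k l).

Lemma smooth_mxW a b W W' (A : M -> 'M[R]_(a, b)) :
  W' `<=` W -> smooth_mx W A -> smooth_mx W' A.
Proof. by move=> sW H k l; exact: smooth_onW (H k l). Qed.

Lemma smooth_mx_eq a b W (A B : M -> 'M[R]_(a, b)) : open W ->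
  (forall p, W p -> A p = B p) -> smooth_mx W A -> smooth_mx W B.
Proof.
move=> oW AB H k l; apply: (smooth_on_eq oW _ (H k l)) => p Wp; by rewrite AB.
Qed.

Lemma smooth_mx_local a b W (A : M -> 'M[R]_(a, b)) : open W ->
  (forall p, W p -> exists2 N : set M, open N /\ N p & smooth_mx (W `&` N) A) ->
  smooth_mx W A.
Proof.
by move=> oW H k l; apply: smooth_on_local => // p /H[N oN HN]; exists N.
Qed.

Lemma smooth_mx_cst a b W (A : 'M[R]_(a, b)) : smooth_mx W (fun=> A).
Proof. by move=> k l; exact: smooth_on_cst. Qed.

Lemma smooth_mxD a b W (A B : M -> 'M[R]_(a, b)) : open W ->
  smooth_mx W A -> smooth_mx W B -> smooth_mx W (fun p => A p + B p).
Proof.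
move=> oW HA HB k l; apply: (smooth_on_eq oW _ (smooth_onD oW (HA k l) (HB k l))).
by move=> p _; rewrite mxE.
Qed.

Lemma smooth_mxZ a b W f (A : M -> 'M[R]_(a, b)) : open W ->
  smooth_on W f -> smooth_mx W A -> smooth_mx W (fun p => f p *: A p).
Proof.
move=> oW Hf HA k l; apply: (smooth_on_eq oW _ (smooth_onM oW Hf (HA k l))).
by move=> p _; rewrite mxE.
Qed.

Lemma smooth_mxM a b c W (A : M -> 'M[R]_(a, b)) (B : M -> 'M[R]_(b, c)) :
  open W -> smooth_mx W A -> smooth_mx W B -> smooth_mx W (fun p => A p *m B p).
Proof.
move=> oW HA HB k l.
have H := smooth_on_sum (index_enum 'I_b) (P := xpredT) oW
  (fun j _ => smooth_onM oW (HA k j) (HB j l)).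
by apply: (smooth_on_eq oW _ H) => p _; rewrite mxE.
Qed.

Lemma smooth_on_det a W (A : M -> 'M[R]_a) : open W -> smooth_mx W A ->
  smooth_on W (fun p => \det (A p)).
Proof.
move=> oW HA; rewrite /determinant; apply: smooth_on_sum => // s _.
apply: smooth_onM => //; first exact: smooth_on_cst.
by apply: smooth_on_prod => // j _; exact: HA.
Qed.

Lemma smooth_mx_inv a W (A : M -> 'M[R]_a) : open W ->
  (forall p, W p -> A p \in unitmx) ->
  smooth_mx W A -> smooth_mx W (fun p => invmx (A p)).
Proof.
move=> oW uA HA.
have dA p : W p -> \det (A p) != 0.
  by move=> /uA; rewrite unitmxE unitfE.
apply: (@smooth_mx_eq _ _ W (fun p => (\det (A p))^-1 *: \adj (A p))) => //.
  by move=> p /uA u; rewrite /invmx u.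
apply: smooth_mxZ => //; first by apply: smooth_onV => //; exact: smooth_on_det.
move=> k l; rewrite (_ : (fun p => _) = fun p => cofactor (A p) l k); last first.
  by apply/funext => p; rewrite mxE.
rewrite /cofactor; apply: smooth_onM => //; first exact: smooth_on_cst.
apply: smooth_on_det => // k' l'.
rewrite (_ : (fun p => _) = fun p => A p (lift l k') (lift k l')); first exact: HA.
by apply/funext => p; rewrite !mxE.
Qed.

End SmoothManifold.

(* A real vector bundle of rank r given by its fibres and an atlas of fibrewise
   linear trivializations triv i p : E_p -> R^r over the open sets triv_dom i,
   whose transition functions M -> GL_r(R) are smooth; this determines the
   topology and smooth structure of the total space.  triv i p is meaningful only
   for p in triv_dom i.  Vectors are rows, so linear maps act on the right. *)
Record vector_bundle (R : realType) (n : nat) (M : manifold R n) (r : nat) :=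
VectorBundle {
  fiber :> M -> vectType R;
  triv_idx : Type;
  triv_dom : triv_idx -> set M;
  triv : triv_idx -> forall p, 'Hom(fiber p, 'rV[R]_r);
  triv_dom_open : forall i, open (triv_dom i);
  triv_cover : forall p, exists i, triv_dom i p;
  triv_bij : forall i p, triv_dom i p -> bijective (triv i p);
  triv_smooth : forall i j, smooth_mx (triv_dom i `&` triv_dom j)
    (fun p => lin1_mx (triv j p \o (triv i p)^-1)%VF)
}.

Section Bundles.
Variables (R : realType) (n : nat) (M : manifold R n).

Lemma lfun_bijK (U V : vectType R) (f : 'Hom(U, V)) :
  bijective f -> cancel f (f^-1)%VF /\ cancel (f^-1)%VF f.
Proof.
move=> bf; have fK : cancel f (f^-1)%VF.
  by apply: lker0_lfunK; apply/lker0P/bij_inj.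
split=> // v; have [g _ gK] := bf; by rewrite -{1}(gK v) fK.
Qed.

Lemma lin1_mx_lfun a b (f : 'Hom('rV[R]_a, 'rV[R]_b)) u : u *m lin1_mx f = f u.
Proof. exact: mul_rV_lin1. Qed.

Lemma mx_rowP a b (A B : 'M[R]_(a, b)) : (forall u : 'rV_a, u *m A = u *m B) -> A = B.
Proof. by move=> H; apply/row_matrixP => i; rewrite !rowE. Qed.

Lemma trivK r (E : vector_bundle M r) i p : triv_dom i p ->
  cancel (triv (v:=E) i p) ((triv i p)^-1)%VF.
Proof. by move=> /triv_bij /lfun_bijK[]. Qed.

Lemma trivVK r (E : vector_bundle M r) i p : triv_dom i p ->
  cancel ((triv (v:=E) i p)^-1)%VF (triv i p).
Proof. by move=> /triv_bij /lfun_bijK[]. Qed.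

Record section r (E : vector_bundle M r) := Section {
  section_fun :> forall p, E p;
  section_smooth : forall i,
    smooth_mx (triv_dom i) (fun p => triv i p (section_fun p))
}.

(* The matrix of h : E_p -> F_p in the trivializations i of E and j of F. *)
Definition local_mx r s (E : vector_bundle M r) (F : vector_bundle M s)
    (i : triv_idx E) (j : triv_idx F) (p : M) (h : 'Hom(E p, F p)) : 'M[R]_(r, s) :=
  lin1_mx (triv j p \o h \o (triv i p)^-1)%VF.

(* Smooth vector bundle morphisms covering the identity of M. *)
Record bundle_hom r s (E : vector_bundle M r) (F : vector_bundle M s) :=
BundleHom {
  bundle_hom_fun :> forall p, 'Hom(E p, F p);
  bundle_hom_smooth : forall i j, smooth_mx (triv_dom i `&` triv_dom j)
    (fun p => local_mx i j (bundle_hom_fun p))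
}.

Lemma section_eq r (E : vector_bundle M r) (u v : section E) :
  (forall p, u p = v p) -> u = v.
Proof.
case: u v => [u Hu] [v Hv] /= uv; have {uv}uv : u = v by exact/functional_extensionality_dep.
by subst v; congr Section; exact: Prop_irrelevance.
Qed.

Section SectionOps.
Variables (r : nat) (E : vector_bundle M r).
Implicit Types u v : section E.

Lemma section_add_smooth u v i :
  smooth_mx (triv_dom i) (fun p => triv i p (u p + v p)).
Proof.
apply: (smooth_mx_eq _ _ (smooth_mxD _ (section_smooth u i) (section_smooth v i)));
  try exact: triv_dom_open.
by move=> p _; rewrite linearD.
Qed.

Lemma section_fscale_smooth (f : M -> R) u i : smooth_on setT f ->
  smooth_mx (triv_dom i) (fun p => triv i p (f p *: u p)).
Proof.
move=> Hf; have Hf' : smooth_on (@triv_dom _ _ _ _ E i) f by exact: smooth_onW Hf.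
apply: (smooth_mx_eq _ _ (smooth_mxZ _ Hf' (section_smooth u i)));
  try exact: triv_dom_open.
by move=> p _; rewrite linearZ.
Qed.

Lemma section_zero_smooth i :
  smooth_mx (triv_dom i) (fun p => triv i p (0 : E p)).
Proof.
apply: (smooth_mx_eq _ _ (smooth_mx_cst _ 0)); first exact: triv_dom_open.
by move=> p _; rewrite linear0.
Qed.

Definition section_add u v := Section (section_add_smooth u v).
Definition section_scale (c : R) u :=
  Section (fun i => section_fscale_smooth u i (smooth_on_cst setT c)).
Definition section_zero := Section section_zero_smooth.

(* The real vector space of smooth sections. *)
HB.instance Definition _ := gen_eqMixin (section E).
HB.instance Definition _ := gen_choiceMixin (section E).

Lemma section_addA : associative section_add.
Proof. by move=> u v w; apply: section_eq => p /=; rewrite addrA. Qed.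
Lemma section_addC : commutative section_add.
Proof. by move=> u v; apply: section_eq => p /=; rewrite addrC. Qed.
Lemma section_add0 : left_id section_zero section_add.
Proof. by move=> u; apply: section_eq => p /=; rewrite add0r. Qed.
Lemma section_addN : left_inverse section_zero (section_scale (-1)) section_add.
Proof. by move=> u; apply: section_eq => p /=; rewrite scaleN1r addNr. Qed.

HB.instance Definition _ := GRing.isZmodule.Build (section E)
  section_addA section_addC section_add0 section_addN.

Lemma section_scaleA a b u :
  section_scale a (section_scale b u) = section_scale (a * b) u.
Proof. by apply: section_eq => p /=; rewrite scalerA. Qed.
Lemma section_scale1 : left_id 1 section_scale.
Proof. by move=> u; apply: section_eq => p /=; rewrite scale1r. Qed.
Lemma section_scaleDr : right_distributive section_scale +%R.
Proof. by move=> a u v; apply: section_eq => p /=; rewrite scalerDr. Qed.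
Lemma section_scaleDl u : {morph section_scale^~ u : a b / a + b}.
Proof. by move=> a b; apply: section_eq => p /=; rewrite scalerDl. Qed.

HB.instance Definition _ := GRing.Zmodule_isLmodule.Build R (section E)
  section_scaleA section_scale1 section_scaleDr section_scaleDl.

End SectionOps.

Record smooth_function := SmoothFunction {
  smooth_function_fun :> M -> R;
  smooth_functionP : smooth_on setT smooth_function_fun
}.

Definition section_fscale r (E : vector_bundle M r) (f : smooth_function) (u : section E) : section E :=
  Section (fun i => section_fscale_smooth u i (smooth_functionP f)).

Lemma bundle_hom_section_smooth r s (E : vector_bundle M r) (F : vector_bundle M s)
  (h : bundle_hom E F) (u : section E) j :
  smooth_mx (triv_dom j) (fun p => triv j p (h p (u p))).
Proof.
apply: smooth_mx_local => [|p jp]; first exact: triv_dom_open.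
have [i ip] := triv_cover E p; exists (triv_dom i).
  by split=> //; exact: triv_dom_open.
rewrite setIC.
have oW : open (@triv_dom _ _ _ _ E i `&` @triv_dom _ _ _ _ F j).
  by apply: openI; exact: triv_dom_open.
apply: (smooth_mx_eq oW _ (smooth_mxM oW (smooth_mxW _ (section_smooth u i))
  (bundle_hom_smooth h i j))).
  by move=> q [iq jq]; rewrite lin1_mx_lfun !comp_lfunE trivK.
by move=> q [].
Qed.

Definition bundle_hom_section r s (E : vector_bundle M r) (F : vector_bundle M s)
  (h : bundle_hom E F) (u : section E) : section F :=
  Section (bundle_hom_section_smooth h u).

Lemma bundle_hom_comp_smooth r s t (E : vector_bundle M r) (F : vector_bundle M s)
  (G : vector_bundle M t) (g : bundle_hom F G) (h : bundle_hom E F) i k :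
  smooth_mx (triv_dom i `&` triv_dom k) (fun p => local_mx i k (g p \o h p)%VF).
Proof.
have oik : open (@triv_dom _ _ _ _ E i `&` @triv_dom _ _ _ _ G k).
  by apply: openI; exact: triv_dom_open.
apply: smooth_mx_local => // p [ip kp].
have [j jp] := triv_cover F p; exists (triv_dom j).
  by split=> //; exact: triv_dom_open.
have oW : open ((@triv_dom _ _ _ _ E i `&` @triv_dom _ _ _ _ G k) `&` @triv_dom _ _ _ _ F j).
  by apply: openI => //; exact: triv_dom_open.
apply: (smooth_mx_eq oW _ (smooth_mxM oW (smooth_mxW _ (bundle_hom_smooth h i j))
  (smooth_mxW _ (bundle_hom_smooth g j k)))).
- move=> q [[iq kq] jq]; apply: mx_rowP => u.
  by rewrite mulmxA !lin1_mx_lfun !comp_lfunE trivK.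
- by move=> q [[]].
- by move=> q [[]].
Qed.

Definition bundle_hom_comp r s t (E : vector_bundle M r) (F : vector_bundle M s)
  (G : vector_bundle M t) (g : bundle_hom F G) (h : bundle_hom E F) :
  bundle_hom E G := BundleHom (bundle_hom_comp_smooth g h).

End Bundles.

Lemma derive_comp_app (R : numFieldType) (U V W : normedModType R) (f : U -> V)
    (g : V -> W) x v : differentiable f x -> differentiable g (f x) ->
  'D_v (g \o f) x = 'D_('D_v f x) g (f x).
Proof.
move=> df dg; rewrite !deriveE //; last exact: differentiable_comp.
by rewrite (diff_comp df dg).
Qed.

Section Tangent.
Variables (R : realType) (n : nat) (M : manifold R n).

(* A tangent vector at p is represented by its coordinates in a chosen chart
   around p; its coordinates in any other chart i, given by tangent_triv i, are
   obtained by applying the Jacobian of the change of charts.  The choice of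
   chart_at p, which need not vary continuously with p, is immaterial: only the
   trivializations determine the bundle. *)
Definition chart_at (p : M) : chart_idx M := projT1 (cid (chart_cover p)).

Lemma chart_atP p : chart_dom (chart_at p) p.
Proof. exact: projT2 (cid (chart_cover p)). Qed.

Definition chart_trans (i j : chart_idx M) : 'rV[R]_n -> 'rV[R]_n :=
  chart j \o chart_inv i.

Definition tangent_triv (i : chart_idx M) (p : M) : 'Hom('rV[R]_n, 'rV[R]_n) :=
  linfun (mulmxr ('J (chart_trans (chart_at p) i) (chart (chart_at p) p))).

Lemma chart_trans_diff i j p : chart_dom i p -> chart_dom j p ->
  differentiable (chart_trans i j) (chart i p).
Proof.
move=> ip jp; apply: differentiable_rV => l.
by apply: (chart_smooth i j l 1%N).1; exists p.
Qed.

Lemma chart_trans_comp i j k p v :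
  chart_dom i p -> chart_dom j p -> chart_dom k p ->
  'D_('D_v (chart_trans i j) (chart i p)) (chart_trans j k) (chart j p) =
  'D_v (chart_trans i k) (chart i p).
Proof.
move=> ip jp kp.
have jE : chart j p = chart_trans i j (chart i p) by rewrite /chart_trans /= chartK.
have dij := chart_trans_diff ip jp; have djk := chart_trans_diff jp kp.
rewrite jE in djk *.
rewrite -(derive_comp_app v dij djk).
apply: near_eq_derive.
have oij : open (chart i @` (chart_dom i `&` chart_dom j)).
  by apply: chart_img_open; exact: chart_dom_open.
have : nbhs (chart i p) (chart i @` (chart_dom i `&` chart_dom j)).
  by apply: open_nbhs_nbhs; split => //; exists p.
by apply: filterS => _ [q [iq jq] <-]; rewrite /chart_trans /= !chartK.
Qed.

Lemma chart_trans_id i p v : chart_dom i p ->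
  'D_v (chart_trans i i) (chart i p) = v.
Proof.
move=> ip; rewrite -[RHS](@derive_id _ _ (chart i p)).
apply: near_eq_derive.
have : nbhs (chart i p) (chart i @` chart_dom i).
  by apply: open_nbhs_nbhs; split; [exact: chart_cod_open|exists p].
by apply: filterS => _ [q iq <-]; rewrite /chart_trans /= !chartK.
Qed.

Lemma tangent_trivD i p v : chart_dom i p ->
  tangent_triv i p v = 'D_v (chart_trans (chart_at p) i) (chart (chart_at p) p).
Proof.
move=> ip; rewrite lfunE /= deriveEjacobian //.
by apply: chart_trans_diff => //; exact: chart_atP.
Qed.

Lemma tangent_triv_bij i p : chart_dom i p -> bijective (tangent_triv i p).
Proof.
move=> ip; have cp := chart_atP p.
exists (fun v => 'D_v (chart_trans i (chart_at p)) (chart i p)) => v;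
  by rewrite tangent_trivD // chart_trans_comp // chart_trans_id.
Qed.

Lemma tangent_trivE i j p v : chart_dom i p -> chart_dom j p ->
  tangent_triv j p (((tangent_triv i p)^-1)%VF v) =
  'D_v (chart_trans i j) (chart i p).
Proof.
move=> ip jp; have cp := chart_atP p.
have [_ e] := lfun_bijK (tangent_triv_bij ip).
suff H w : tangent_triv j p w = 'D_(tangent_triv i p w) (chart_trans i j) (chart i p).
  by rewrite H e.
apply: etrans (tangent_trivD w jp) _; rewrite (tangent_trivD w ip).
exact/esym/chart_trans_comp.
Qed.

Lemma tangent_triv_smooth i j : smooth_mx (chart_dom i `&` chart_dom j)
  (fun p => lin1_mx (tangent_triv j p \o (tangent_triv i p)^-1)%VF).
Proof.
move=> k l.
have oj := @chart_dom_open _ _ M j.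
have oij : open (@chart_dom _ _ M i `&` chart_dom j).
  by apply: openI => //; exact: chart_dom_open.
have H : Cinf_on (chart i @` (chart_dom i `&` chart_dom j))
    ('D_(delta_mx 0 k) (fun x => chart_trans i j x 0 l)).
  by move=> m; exact: (chart_smooth i j l m.+1).2.
apply: (smooth_on_eq oij _ (smooth_on_chart oj H)) => p [ip jp].
rewrite !mxE comp_lfunE tangent_trivE // derive_mx ?mxE //.
exact/diff_derivable/chart_trans_diff.
Qed.

Definition tangent_bundle : vector_bundle M n :=
  @VectorBundle R n M n (fun=> 'rV[R]_n : vectType R) (chart_idx M) (@chart_dom R n M)
    tangent_triv (@chart_dom_open R n M) (@chart_cover R n M) tangent_triv_bij tangent_triv_smooth.

(* v(f): the derivative of f along v, computed in the chart at p.  It can be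
   computed in any chart around p (tangent_act_chart). *)
Definition tangent_act (p : M) (v : tangent_bundle p) (f : M -> R) : R :=
  'D_(v : 'rV[R]_n) (f \o chart_inv (chart_at p)) (chart (chart_at p) p).

Lemma tangent_act_chart i p (v : tangent_bundle p) f :
  smooth_on setT f -> chart_dom i p ->
  tangent_act v f = 'D_(tangent_triv i p v) (f \o chart_inv i) (chart i p).
Proof.
move=> Hf ip; have cp := chart_atP p.
have dfi : differentiable (f \o @chart_inv _ _ M i) (chart i p).
  by apply: (Hf i 1%N).1; exists p.
have E : chart i p = chart_trans (chart_at p) i (chart (chart_at p) p).
  by rewrite /chart_trans /= chartK.
have dt := chart_trans_diff cp ip.
rewrite tangent_trivD //; rewrite E in dfi *; rewrite -derive_comp_app //.
apply: near_eq_derive.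
have : nbhs (chart (chart_at p) p)
    (chart (chart_at p) @` (chart_dom (chart_at p) `&` chart_dom i)).
  apply: open_nbhs_nbhs; split; last by exists p.
  by apply: chart_img_open; exact: chart_dom_open.
by apply: filterS => _ [q [jq iq] <-]; rewrite /chart_trans /= !chartK.
Qed.

Lemma tangent_act_smooth (X : section tangent_bundle) (f : smooth_function M) :
  smooth_on setT (fun p => tangent_act (X p) f).
Proof.
apply: smooth_on_local => [|p _]; first exact: openT.
have [i ip] := chart_cover p.
exists (chart_dom i); first by split => //; exact: chart_dom_open.
have oi := @chart_dom_open _ _ M i.
rewrite setTI.
have H l : smooth_on (@chart_dom _ _ M i)
    (fun q => 'D_(delta_mx 0 l) (f \o chart_inv i) (chart i q)).
  have := @smooth_on_chart R n M i setT ('D_(delta_mx 0 l) (f \o chart_inv i)) openT.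
  rewrite setIT; apply => k; have := (smooth_functionP f i k.+1).2 l.
  by rewrite setIT.
have S := smooth_on_sum (index_enum 'I_n) (P := xpredT) oi
  (fun l _ => smooth_onM oi (section_smooth X i 0 l) (H l)).
apply: (smooth_on_eq oi _ S) => q iq /=.
rewrite (tangent_act_chart _ (smooth_functionP f) iq).
rewrite deriveE; last by apply: (smooth_functionP f i 1%N).1; exists q.
rewrite [X in 'd _ _ X]row_sum_delta linear_sum; apply: eq_bigr => l _.
rewrite linearZ /= deriveE //.
by apply: (smooth_functionP f i 1%N).1; exists q.
Qed.

Definition vector_field_act (X : section tangent_bundle) (f : smooth_function M) :
  smooth_function M := SmoothFunction (tangent_act_smooth X f).

End Tangent.

Definition low_mx (R : fieldType) (s r : nat) : 'M[R]_(s, r) :=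
  \matrix_(k, l) ((l == k :> nat)%:R).

Definition high_mx (R : fieldType) (s r m : nat) : 'M[R]_(m, r) :=
  \matrix_(k, l) ((l == (s + k)%N :> nat)%:R).

Section Complement.
Variables (R : fieldType) (s r m : nat).
Local Notation lo := (low_mx R s r).
Local Notation hi := (high_mx R s r m).

Hypothesis e : r = (s + m)%N.

Lemma low_high_mxE : [/\ lo *m lo^T = 1%:M, lo *m hi^T = 0,
  hi *m lo^T = 0, hi *m hi^T = 1%:M &
  lo^T *m lo + hi^T *m hi = 1%:M].
Proof.
subst r.
have -> : low_mx R s (s + m) = row_mx 1%:M 0.
  apply/matrixP => k l; rewrite !mxE; case: splitP => l' ->; rewrite !mxE.
    by rewrite eq_sym.
  by rewrite gtn_eqF // ltn_addr.
have -> : high_mx R s (s + m) m = row_mx 0 1%:M.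
  apply/matrixP => k l; rewrite !mxE; case: splitP => l' ->; rewrite !mxE.
    by rewrite ltn_eqF // ltn_addr.
  by rewrite eqn_add2l eq_sym.
split; rewrite !tr_row_mx ?trmx0 ?trmx1 ?mul_row_col ?mul_col_row
  ?mulmx0 ?mul0mx ?mulmx1 ?addr0 ?add0r //.
rewrite add_block_mx !addr0 !add0r -scalar_mx_block //.
Qed.

Lemma complement_mx (T : 'M[R]_(r, s)) : row_full T ->
  exists S : 'M[R]_(r, m), T *m lo + S *m hi \in unitmx.
Proof.
move=> fT; have [PP PQ QP QQ PQE] := low_high_mxE.
have rT : \rank T = s by exact/eqP.
have TE : T = col_ebase T *m lo^T *m row_ebase T.
  rewrite -{1}(mulmx_ebase T) rT; congr (_ *m _ *m _).
  by apply/matrixP => k l; rewrite !mxE; case: eqP => // ->; rewrite ltn_ord.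
exists (col_ebase T *m hi^T).
have -> : T *m lo + col_ebase T *m hi^T *m hi =
    col_ebase T *m (lo^T *m row_ebase T *m lo + hi^T *m hi).
  by rewrite {1}TE mulmxDr !mulmxA.
rewrite unitmx_mul col_ebase_unit /=.
suff H : (lo^T *m row_ebase T *m lo + hi^T *m hi) *m
  (lo^T *m invmx (row_ebase T) *m lo + hi^T *m hi) = 1%:M.
  by have [] := mulmx1_unit H.
rewrite mulmxDl !mulmxDr !mulmxA.
rewrite -(mulmxA (_ *m row_ebase T) lo lo^T) PP mulmx1.
rewrite mulmxK ?row_ebase_unit // -(mulmxA (_ *m row_ebase T) lo hi^T) PQ.
rewrite -(mulmxA hi^T hi lo^T) QP -(mulmxA hi^T hi hi^T) QQ.
by rewrite mulmx1 !(mulmx0, mul0mx) addr0 add0r PQE.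
Qed.

Lemma complement_kernel (T : 'M[R]_(r, s)) (S : 'M[R]_(r, m)) :
  T *m lo + S *m hi \in unitmx ->
  (forall v : 'rV_r, v *m T = 0 ->
     v *m S *m hi *m invmx (T *m lo + S *m hi) = v) /\
  (forall w : 'rV_m,
     w *m hi *m invmx (T *m lo + S *m hi) *m T = 0 /\
     w *m hi *m invmx (T *m lo + S *m hi) *m S = w).
Proof.
move=> uN; have [PP PQ QP QQ PQE] := low_high_mxE.
split=> [v v0|w].
  have -> : v *m S *m hi = v *m (T *m lo + S *m hi).
    by rewrite mulmxDr !mulmxA v0 mul0mx add0r.
  by rewrite mulmxK.
set N := T *m lo + S *m hi in uN *; set v := w *m hi *m invmx N.
have H : v *m T *m lo + v *m S *m hi = w *m hi.
  by rewrite -(mulmxA v T) -(mulmxA v S) -mulmxDr -/N /v mulmxKV.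
split.
  have := congr1 (mulmx^~ lo^T) H.
  by rewrite mulmxDl -!mulmxA PP QP !mulmx0 !mulmx1 addr0.
have := congr1 (mulmx^~ hi^T) H.
by rewrite mulmxDl -!mulmxA PQ QQ !mulmx0 !mulmx1 add0r.
Qed.

End Complement.

Section KernelBundle.
Variables (R : realType) (n : nat) (M : manifold R n) (r s : nat).
Variables (E : vector_bundle M r) (F : vector_bundle M s) (h : bundle_hom E F).

Definition bundle_surj : Prop := forall p, limg (h p) = fullv.

Hypothesis hs : bundle_surj.

Let m := (r - s)%N.
Let low := low_mx R s r.
Let high := high_mx R s r m.

(* The kernel of a surjective morphism h : E -> F.  For a fixed matrix S with
   r - s columns, v |-> v *m S restricts to an isomorphism from the kernel of the
   r x s matrix T of h_p onto R^(r - s) iff the r x r block matrix [T S], which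
   is kernel_frame, is invertible.  These isomorphisms are the trivializations. *)
Definition kernel_fiber (p : M) : vectType R := subvs_of (lker (h p)).

Definition kernel_idx : Type := (triv_idx E * triv_idx F * 'M[R]_(r, m))%type.

Definition kernel_frame (a : kernel_idx) (p : M) : 'M[R]_r :=
  local_mx a.1.1 a.1.2 (h p) *m low + a.2 *m high.

Definition kernel_dom (a : kernel_idx) : set M :=
  triv_dom a.1.1 `&` triv_dom a.1.2 `&` [set p | kernel_frame a p \in unitmx].

Definition kernel_triv (a : kernel_idx) (p : M) : 'Hom(kernel_fiber p, 'rV[R]_m) :=
  linfun (mulmxr a.2 \o triv a.1.1 p \o vsval).

Lemma local_mxE i j p (g : 'Hom(E p, F p)) v : triv_dom i p ->
  triv i p v *m local_mx i j g = triv j p (g v).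
Proof. by move=> ip; rewrite lin1_mx_lfun !comp_lfunE trivK. Qed.

Lemma local_mx_full i j p : triv_dom i p -> triv_dom j p ->
  row_full (local_mx i j (h p)).
Proof.
move=> ip jp; apply/row_fullP.
have H (w : 'rV_s) : exists v : 'rV_r, v *m local_mx i j (h p) = w.
  have : ((triv j p)^-1)%VF w \in limg (h p) by rewrite hs memvf.
  case/memv_imgP => v _ e; exists (triv i p v).
  by rewrite local_mxE // -e trivVK.
exists (\matrix_k sval (cid (H (row k 1%:M)))).
by apply/row_matrixP => k; rewrite row_mul rowK (svalP (cid (H _))).
Qed.

Lemma rank_split (p : M) : r = (s + m)%N.
Proof.
have [i ip] := triv_cover E p; have [j jp] := triv_cover F p.
have := local_mx_full ip jp; rewrite /row_full => /eqP e.
by rewrite /m subnKC // -e rank_leq_row.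
Qed.

Let W i j := @triv_dom _ _ _ _ E i `&` @triv_dom _ _ _ _ F j.

Let oW i j : open (W i j).
Proof. by apply: openI; exact: triv_dom_open. Qed.

Lemma kernel_frame_smooth a : smooth_mx (W a.1.1 a.1.2) (kernel_frame a).
Proof.
apply: smooth_mxD => //; last exact: smooth_mx_cst.
by apply: smooth_mxM => //; [exact: bundle_hom_smooth|exact: smooth_mx_cst].
Qed.

Lemma kernel_dom_open a : open (kernel_dom a).
Proof.
rewrite openE => p [Wp up]; rewrite /interior.
have c := smooth_on_continuous (oW _ _) (smooth_on_det (oW _ _) (kernel_frame_smooth a)) Wp.
have H1 : nbhs p (W a.1.1 a.1.2) by exact: open_nbhs_nbhs.
have d0 : \det (kernel_frame a p) != 0 by move: up; rewrite /= unitmxE unitfE.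
have H2 : nbhs p ((fun q => \det (kernel_frame a q)) @^-1` [set x | x != 0]).
  apply: c; apply: open_nbhs_nbhs; split => //; exact: open_neq.
by apply: filterS2 H1 H2 => q Wq; rewrite /= => dq; split => //=; rewrite unitmxE unitfE.
Qed.

Lemma kernel_cover p : exists a, kernel_dom a p.
Proof.
have [i ip] := triv_cover E p; have [j jp] := triv_cover F p.
have [S uS] := complement_mx (rank_split p) (local_mx_full ip jp).
by exists (i, j, S).
Qed.

Definition kernel_lift (a : kernel_idx) (p : M) (w : 'rV[R]_m) : E p :=
  ((triv a.1.1 p)^-1)%VF (w *m high *m invmx (kernel_frame a p)).

Lemma kernel_lift_ker a p w : kernel_dom a p -> kernel_lift a p w \in lker (h p).
Proof.
move=> [[ip jp] up]; rewrite memv_ker; apply/eqP.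
apply: (can_inj (trivK jp)); rewrite linear0 -(local_mxE _ _ _ ip) trivVK //.
by have [_ /(_ w)[]] := complement_kernel (rank_split p) up.
Qed.

Lemma kernel_trivE a p u : kernel_triv a p u = triv a.1.1 p (vsval u) *m a.2.
Proof. by rewrite lfunE. Qed.

Lemma kernel_lift_triv a p u : kernel_dom a p ->
  kernel_lift a p (kernel_triv a p u) = vsval u.
Proof.
move=> [[ip jp] up]; have [H _] := complement_kernel (rank_split p) up.
rewrite /kernel_lift kernel_trivE H ?trivK // local_mxE //.
have := subvsP u; rewrite memv_ker => /eqP ->; exact: linear0.
Qed.

Lemma kernel_triv_bij a p : kernel_dom a p -> bijective (kernel_triv a p).
Proof.
move=> ap; exists (fun w => Subvs (kernel_lift_ker w ap)).
  by move=> u; apply: val_inj; rewrite /= kernel_lift_triv.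
move=> w; rewrite kernel_trivE /=; have [[ip jp] up] := ap.
have [_ /(_ w)[_ H]] := complement_kernel (rank_split p) up.
by rewrite /kernel_lift trivVK.
Qed.

Lemma kernel_triv_inv a p w : kernel_dom a p ->
  vsval (((kernel_triv a p)^-1)%VF w) = kernel_lift a p w.
Proof.
move=> ap; have [_ H] := lfun_bijK (kernel_triv_bij ap).
by rewrite -[RHS]/(kernel_lift a p w) -(kernel_lift_triv _ ap) H.
Qed.

Lemma kernel_lift_smooth a i : smooth_mx (kernel_dom a `&` triv_dom i)
  (fun p => high *m invmx (kernel_frame a p) *m
            lin1_mx (triv i p \o (triv a.1.1 p)^-1)%VF).
Proof.
have oK : open (kernel_dom a `&` @triv_dom _ _ _ _ E i).
  by apply: openI; [exact: kernel_dom_open|exact: triv_dom_open].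
apply: smooth_mxM => //; last first.
  by apply: smooth_mxW (triv_smooth a.1.1 i) => p [[[]]].
apply: smooth_mxM => //; first exact: smooth_mx_cst.
apply: smooth_mx_inv => //; first by move=> p [[_ ]].
by apply: smooth_mxW (kernel_frame_smooth a) => p [[]].
Qed.

Lemma kernel_triv_smooth a b : smooth_mx (kernel_dom a `&` kernel_dom b)
  (fun p => lin1_mx (kernel_triv b p \o (kernel_triv a p)^-1)%VF).
Proof.
have oab : open (kernel_dom a `&` kernel_dom b).
  by apply: openI; exact: kernel_dom_open.
apply: (smooth_mx_eq oab _ (smooth_mxM oab (smooth_mxW _ (@kernel_lift_smooth a b.1.1))
  (smooth_mx_cst _ b.2))).
  move=> p [ap bp]; apply: mx_rowP => w.
  rewrite lin1_mx_lfun comp_lfunE kernel_trivE kernel_triv_inv //.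
  by rewrite !mulmxA lin1_mx_lfun comp_lfunE.
by move=> p [ap [[bp _] _]].
Qed.

Definition kernel_bundle : vector_bundle M (r - s) :=
  VectorBundle kernel_dom_open kernel_cover kernel_triv_bij kernel_triv_smooth.

Definition kernel_incl_fun (p : M) : 'Hom(kernel_bundle p, E p) := linfun vsval.

Lemma kernel_incl_smooth (a : triv_idx kernel_bundle) i :
  smooth_mx (triv_dom a `&` triv_dom i) (fun p => local_mx a i (kernel_incl_fun p)).
Proof.
have oK : open (kernel_dom a `&` @triv_dom _ _ _ _ E i).
  by apply: openI; [exact: kernel_dom_open|exact: triv_dom_open].
apply: (smooth_mx_eq oK _ (@kernel_lift_smooth a i)) => p [ap ip].
apply: mx_rowP => w; rewrite lin1_mx_lfun !comp_lfunE lfunE /=.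
by rewrite kernel_triv_inv // !mulmxA lin1_mx_lfun comp_lfunE.
Qed.

Definition kernel_incl : bundle_hom kernel_bundle E := BundleHom kernel_incl_smooth.

Lemma kernel_inclE (u : section kernel_bundle) p :
  bundle_hom_section kernel_incl u p = vsval (u p).
Proof. exact: lfunE. Qed.

Lemma kernel_incl_inj : injective (bundle_hom_section kernel_incl).
Proof.
move=> u v e; apply: section_eq => p; apply: val_inj.
by rewrite -[LHS]kernel_inclE -[RHS]kernel_inclE e.
Qed.

(* The sections of the kernel bundle are the sections of E annihilated by h. *)
Lemma kernel_inclP (x : section E) :
  (exists u, bundle_hom_section kernel_incl u = x) <->
  (forall p, h p (x p) = 0).
Proof.
split=> [[u <-] p|x0].
  by rewrite kernel_inclE; apply/eqP; rewrite -memv_ker; exact: subvsP.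
have xker p : x p \in lker (h p) by rewrite memv_ker x0.
have sm (a : triv_idx kernel_bundle) : smooth_mx (triv_dom a)
    (fun p => triv a p (Subvs (xker p) : kernel_bundle p)).
  have oa := kernel_dom_open a.
  apply: (smooth_mx_eq oa _ (smooth_mxM oa
    (smooth_mxW _ (section_smooth x a.1.1)) (smooth_mx_cst _ a.2))).
    by move=> p _; rewrite [RHS]kernel_trivE.
  by move=> p [[]].
by exists (Section sm); apply: section_eq => p; rewrite kernel_inclE.
Qed.

End KernelBundle.

Section PostLie.
Variables (R : realType) (V : lmodType R).

Definition is_bilinear (op : V -> V -> V) : Prop :=
  (forall u, linear (op u)) /\ (forall v, linear (op^~ v)).

Record is_lie_bracket (br : V -> V -> V) : Prop := IsLieBracket {
  lie_bilinear : is_bilinear br;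
  lie_alternating : forall u, br u u = 0;
  lie_jacobi : forall u v w, br u (br v w) + br v (br w u) + br w (br u v) = 0
}.

Definition associator (rhd : V -> V -> V) (u v w : V) : V :=
  rhd u (rhd v w) - rhd (rhd u v) w.

Record is_post_lie (br rhd : V -> V -> V) : Prop := IsPostLie {
  post_lie_bracket : is_lie_bracket br;
  post_lie_bilinear : is_bilinear rhd;
  post_lie_derivation : forall u v w,
    rhd u (br v w) = br (rhd u v) w + br v (rhd u w);
  post_lie_associator : forall u v w,
    rhd (br u v) w = associator rhd u v w - associator rhd v u w
}.

End PostLie.

Section Algebroids.
Variables (R : realType) (n : nat) (M : manifold R n).

Record lie_algebroid (r : nat) := LieAlgebroid {
  lie_algebroid_bundle :> vector_bundle M r;
  lie_bracket : section lie_algebroid_bundle -> section lie_algebroid_bundle ->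
    section lie_algebroid_bundle;
  lie_anchor : bundle_hom lie_algebroid_bundle (tangent_bundle M);
  lie_bracketP : is_lie_bracket lie_bracket;
  lie_leibniz : forall (x y : section lie_algebroid_bundle) (f : smooth_function M),
    lie_bracket x (section_fscale f y) =
    section_fscale f (lie_bracket x y) +
    section_fscale (vector_field_act (bundle_hom_section lie_anchor x) f) y
}.

Definition transitive_algebroid r (A : lie_algebroid r) : Prop :=
  bundle_surj (lie_anchor A).

Section RotaBaxter.
Variables (r : nat) (A : lie_algebroid r) (tA : transitive_algebroid A).

Definition anchor_kernel : vector_bundle M (r - n) := kernel_bundle tA.

Definition anchor_kernel_incl : section anchor_kernel -> section A :=
  bundle_hom_section (kernel_incl tA).

(* The brackets in the arguments of B are sections of the kernel of the anchor;
   they are represented by the sections of [anchor_kernel] (unique, since the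
   inclusion is injective, see kernel_incl_inj and kernel_inclP) with the
   prescribed image in the sections of A. *)
Definition is_rota_baxter (lambda : R) (B : bundle_hom anchor_kernel A) : Prop :=
  forall u v Bu_v u_Bv u_v : section anchor_kernel,
    let i := anchor_kernel_incl in
    let b := bundle_hom_section B in
    i Bu_v = lie_bracket (b u) (i v) ->
    i u_Bv = lie_bracket (i u) (b v) ->
    i u_v = lie_bracket (i u) (i v) ->
    lie_bracket (b u) (b v) = b Bu_v + b u_Bv + lambda *: b u_v.

End RotaBaxter.

Record rota_baxter_lie_algebroid (r : nat) := RotaBaxterLieAlgebroid {
  rb_algebroid :> lie_algebroid r;
  rb_transitive : transitive_algebroid rb_algebroid;
  rb_operator : bundle_hom (anchor_kernel rb_transitive) rb_algebroid;
  rb_operatorP : is_rota_baxter 1 rb_operator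
}.

Record is_post_lie_algebroid r (A : vector_bundle M r)
    (br rhd : section A -> section A -> section A)
    (a : bundle_hom A (tangent_bundle M)) : Prop := IsPostLieAlgebroid {
  pla_bracket_linearl : forall (f : smooth_function M) u v,
    br (section_fscale f u) v = section_fscale f (br u v);
  pla_bracket_linearr : forall (f : smooth_function M) u v,
    br u (section_fscale f v) = section_fscale f (br u v);
  pla_post_lie : is_post_lie br rhd;
  pla_leibniz : forall (f : smooth_function M) u v,
    rhd u (section_fscale f v) =
    section_fscale f (rhd u v) +
    section_fscale (vector_field_act (bundle_hom_section a u) f) v;
  pla_linear : forall (f : smooth_function M) u v,
    rhd (section_fscale f u) v = section_fscale f (rhd u v)
}.

End Algebroids.

(* Main.v *)
Require Import Defs.
From HB Require Import structures.
From mathcomp Require Import all_boot all_order all_algebra.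
From mathcomp Require Import all_classical all_reals all_analysis.
From mathcomp Require Import ring.
Set Implicit Arguments.
Unset Strict Implicit.
Unset Printing Implicit Defensive.
Import Order.TTheory GRing.Theory Num.Theory.
Import numFieldNormedType.Exports.
Local Open Scope classical_set_scope.
Local Open Scope ring_scope.

(** Put u |> v := [B u, v].  Once the brackets [x, v] of an arbitrary section x
    with a section v of ker a are known to lie in ker a again, every axiom is
    formal.  The derivation rule is the Jacobi identity for B u, v, w.  The
    Rota-Baxter identity reads B [u, v] = [B u, B v] - B (u |> v) + B (v |> u);
    bracketing with w and expanding [[B u, B v], w] by Jacobi gives the
    associator identity.  Over smooth functions, |> inherits its Leibniz rule from
    that of [B u, _] in A; the products that have to be function-linear are so
    because their correction terms are derivatives along sections of ker a,
    whose anchor is zero.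

    The closure of ker a under [x, _] is the substantial point, because a Lie
    algebroid is not assumed to have a bracket-preserving anchor: this is a
    consequence of Jacobi and Leibniz.  Expanding [[x, y], f z] in two ways gives
    (a[x, y] f) z = (a x (a y f) - a y (a x f)) z (anchor_bracket_act).  If
    a y = 0, the right-hand side is zero; taking z = [x, y] shows that at each
    point p either [x, y] vanishes, and then so does its anchor, or the tangent
    vector a[x, y](p) annihilates all globally defined smooth functions
    (bracket_anchor_ker).

    It remains to see that such a tangent vector is zero (tangent_act_eq0), that
    is, that M has enough global smooth functions.  They are made from the flat
    function exp(-1/t): a bump function with support in a small cube around a
    point of a chart, multiplied by a coordinate, extends by zero to all of M.
    The extension is smooth because the cube is compact, so that its image in
    the Hausdorff space M is closed. *)

(** * The flat function exp(-1/t) *)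

Section FlatFunction.
Variable R : realType.

(** The factor t^-m makes the family closed under differentiation up to linear
    combinations, so that smoothness follows by an induction on the order for
    all m at once. *)
Definition flat (m : nat) (t : R) : R :=
  if 0 < t then t^-1 ^+ m * expR (- t^-1) else 0.

Lemma flat_gt0 m t : 0 < t -> 0 < flat m t.
Proof. by move=> t0; rewrite /flat t0 mulr_gt0 ?expR_gt0 ?exprn_gt0 ?invr_gt0. Qed.

Lemma flat_le0 m t : t <= 0 -> flat m t = 0.
Proof. by rewrite /flat leNgt; case: ltP. Qed.

(** With s = 1/t this is s^(m+2) <= (m+2)! exp s, a single term of the
    exponential series.  The quadratic bound yields the derivative 0 at t = 0. *)
Lemma flat_le_sqr m t : `|flat m t| <= (m.+2)`!%:R * t ^+ 2.
Proof.
have [t0|/flat_le0 ->] := ltP 0 t; last by rewrite normr0 mulr_ge0 ?sqr_ge0.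
rewrite gtr0_norm ?flat_gt0 // /flat t0 expRN ler_pdivrMr ?expR_gt0 //.
have s0 : 0 <= t^-1 by rewrite invr_ge0 ltW.
have H : t^-1 ^+ m.+2 <= (m.+2)`!%:R * expR t^-1.
  rewrite mulrC -ler_pdivrMr ?ltr0n ?fact_gt0 //.
  by apply: le_trans (expR_ge1Dxn m.+1 s0); rewrite lerDr.
have -> : t^-1 ^+ m = t^-1 ^+ m.+2 * t ^+ 2.
  by rewrite -addn2 exprD -mulrA -exprMn mulVf ?gt_eqF // expr1n mulr1.
by rewrite [leRHS]mulrAC ler_wpM2r // sqr_ge0.
Qed.

Lemma is_derive_flat (m : nat) (t : R) :
  is_derive t 1 (flat m) (flat m.+2 t - m%:R * flat m.+1 t).
Proof.
have [t0|t0|->] := ltgtP t 0.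
- rewrite !flat_le0 ?ltW // mulr0 subr0.
  apply: near_eq_is_derive (is_derive_cst 0 t 1).
  by near=> s; rewrite /= flat_le0 //; apply: ltW; near: s; exact: lt_nbhsl.
- have tn0 : t != 0 by rewrite gt_eqF.
  have dV : is_derive t 1 (fun s : R => s^-1) (- t^-1 ^+ 2).
    apply: is_derive_eq; first exact: (is_deriveV tn0 (is_derive_id t 1)).
    by rewrite /= scaler1 exprVn.
  have dE : is_derive t 1 (fun s : R => expR (- s^-1)) (expR (- t^-1) * t^-1 ^+ 2).
    have dN := is_deriveN dV; rewrite opprK in dN.
    exact: (is_derive1_comp (is_derive_expR _) dN).
  have dF := is_deriveM (is_deriveX m dV) dE.
  have nF : \near t, ((fun s : R => s^-1) ^+ m * (fun s : R => expR (- s^-1))) t =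
                     flat m t.
    near=> s; rewrite /flat ifT ?fctE ?exprfctE //.
    by near: s; exact: lt_nbhsr.
  apply: is_derive_eq; first exact: (near_eq_is_derive nF dF).
  rewrite /flat t0 /GRing.scale /= ?exprfctE.
  by case: m {dF nF} => [|m] /=; rewrite ?exprS ?expr0; ring.
(* At t = 0 the difference quotient is at most (m+2)! |h|. *)
rewrite !flat_le0 // mulr0 subr0.
suff H : (fun h : R => h^-1 *: (flat m (h *: 1 + 0) - flat m 0)) @ 0^' --> (0 : R).
  by apply: DeriveDef; [apply/cvg_ex; exists 0|exact: cvg_lim H].
pose c : R := (m.+2)`!%:R.
have cK : (fun h : R => c * `|h|) @ 0^' --> (0 : R).
  have : (fun h : R => c * `|h|) @ (0 : R) --> c * `|0 : R|.
    by apply: cvgM; [exact: cvg_cst|exact: norm_continuous].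
  by rewrite normr0 mulr0; exact: cvg_within_filter.
apply/norm_cvg0P; apply: (squeeze_cvgr _ (cvg_cst 0) cK).
near=> h; rewrite normr_ge0 /= (flat_le0 _ (lexx 0)) subr0 addr0 scaler1.
have h0 : 0 < `|h| by rewrite normr_gt0; near: h; exact: nbhs_dnbhs_neq.
rewrite normrM normfV mulrC ler_pdivrMr // -mulrA -expr2 real_normK ?num_real //.
exact: flat_le_sqr.
Unshelve. all: by end_near. Qed.

End FlatFunction.

(** * Bump functions on Euclidean space *)

Section BumpEuclidean.
Variables (R : realType) (n : nat).
Implicit Types (W : set 'rV[R]_n) (x v : 'rV[R]_n) (e : R).

Lemma derive_coord l x v : 'D_v (fun y : 'rV[R]_n => y 0 l : R) x = v 0 l.
Proof.
have dI : derivable (id : 'rV[R]_n -> 'rV[R]_n) x v by exact: derivable_id.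
have := derive_mx dI.
by move/(congr1 (fun A : 'rV[R]_n => A 0 l)); rewrite derive_id mxE.
Qed.

Lemma Cinf_on_coord W l : Cinf_on W (fun x => x 0 l).
Proof.
case=> [|k]; first by move=> x _; exact/differentiable_continuous/differentiable_coord.
split=> [x _|i]; first exact: differentiable_coord.
rewrite (_ : 'D__ _ = fun=> (delta_mx 0 i : 'rV[R]_n) 0 l); first exact: Ck_on_cst.
by apply/funext => x; exact: derive_coord.
Qed.

(** By the chain rule the partial derivatives of flat m o g are combinations of
    flat (m+2) o g and flat (m+1) o g with the partial derivatives of g, hence
    the induction on the order of differentiability with m general. *)
Lemma Cinf_on_flat m W (g : 'rV[R]_n -> R) : open W -> Cinf_on W g ->
  Cinf_on W (flat m \o g).
Proof.
move=> oW Hg k.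
have dflat j (t : R) : differentiable (flat j) t.
  by apply/derivable1_diffP; have := is_derive_flat j t; case.
have dg x : W x -> differentiable g x by exact: (Hg 1%N).1.
elim: k m => [|k IH] m.
  move=> x Wx; apply: continuous_comp; first exact/differentiable_continuous/dg.
  exact/differentiable_continuous/dflat.
split=> [x Wx|i]; first by apply: differentiable_comp; [exact: dg|exact: dflat].
have H := Ck_onM oW (Ck_onD oW (IH m.+2) (Ck_onM oW (Ck_on_cst k W (- m%:R))
  (IH m.+1))) ((Hg k.+1).2 i).
apply: (Ck_on_eq oW _ H) => x; rewrite inE => Wx.
rewrite [RHS](derive_comp_app _ (dg _ Wx) (dflat m (g x))).
move: ('D_(delta_mx 0 i) g x) => w; rewrite [RHS]deriveE //.
rewrite -[X in 'd _ _ X](mulr1 w) [RHS]linearZ /= -deriveE //.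
have := is_derive_flat m (g x); case=> _ ->.
by rewrite /GRing.scale /= mulNr mulrC.
Qed.

(** The squared Euclidean distance is used because it is smooth; the support is
    then the Euclidean ball, which sits in the cube box x0 e. *)
Definition bump x0 (e : R) x : R := flat 0 (e ^+ 2 - \sum_l (x 0 l - x0 0 l) ^+ 2).

Definition box x0 (e : R) : set 'rV[R]_n :=
  [set x | forall l, x 0 l \in `[x0 0 l - e, x0 0 l + e]].

Lemma box_compact x0 e : compact (box x0 e).
Proof.
by apply: (@rV_compact R n (fun l => [set` `[x0 0 l - e, x0 0 l + e]])) => l; exact: segment_compact.
Qed.

Lemma box_nbhs x0 (U : set 'rV[R]_n) : nbhs x0 U -> exists2 e, 0 < e & box x0 e `<=` U.
Proof.
move=> /nbhs_ballP[e /= e0 eU]; exists (e / 2); first exact: divr_gt0.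
move=> x bx; apply: eU; split=> // k l; rewrite (ord1 k); have := bx l.
rewrite in_itv /= -ball_normE /= -ler_distlC => H.
by apply: le_lt_trans H _; rewrite ltr_pdivrMr // ltr_pMr // ltr1n.
Qed.

Lemma bump_out x0 e x : 0 < e -> ~ box x0 e x -> bump x0 e x = 0.
Proof.
move=> e0 /existsNP[l]; rewrite in_itv /= -ler_distlC distrC => /negP.
rewrite -ltNge => lt; rewrite /bump flat_le0 // subr_le0 (bigD1 l) //=.
apply: ler_wpDr; first by rewrite sumr_ge0 // => j _; rewrite sqr_ge0.
rewrite -(real_normK (num_real (x 0 l - x0 0 l))).
by apply: ltW; rewrite ltrXn2r ?nnegrE ?normr_ge0 ?ltW.
Qed.

Lemma bump_center x0 e : 0 < e -> 0 < bump x0 e x0.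
Proof.
move=> e0; rewrite flat_gt0 // big1 ?subr0 ?exprn_gt0 // => l _.
by rewrite subrr expr0n.
Qed.

Lemma Cinf_onB_cst W l c : open W -> Cinf_on W (fun x => x 0 l - c).
Proof. by move=> oW k; apply: Ck_onD => //; [exact: Cinf_on_coord|exact: Ck_on_cst]. Qed.

Lemma bump_smooth x0 e : Cinf_on setT (bump x0 e).
Proof.
apply: Cinf_on_flat => [|k]; first exact: openT.
have oT : open [set: 'rV[R]_n] := openT.
apply: (Ck_on_eq oT _ (Ck_onD oT (Ck_on_cst k _ (e ^+ 2)) (Ck_onM oT (Ck_on_cst k _ (-1))
  (Ck_on_sum (index_enum 'I_n) oT (fun l => Ck_onM oT
  (Cinf_onB_cst l (x0 0 l) oT k) (Cinf_onB_cst l (x0 0 l) oT k)))))).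
by move=> x _; rewrite mulN1r.
Qed.

(** A compactly supported multiple of a coordinate centred at x0; its derivative
    at x0 involves only the value of the bump there, because the coordinate
    vanishes at x0. *)
Definition bump_coord x0 e l x : R := bump x0 e x * (x 0 l - x0 0 l).

Lemma bump_coord_smooth x0 e l : Cinf_on setT (bump_coord x0 e l).
Proof.
move=> k; have oT : open [set: 'rV[R]_n] := openT.
by apply: Ck_onM => //; [exact: bump_smooth|exact: Cinf_onB_cst].
Qed.

Lemma derive_bump_coord x0 e l v :
  'D_v (bump_coord x0 e l) x0 = bump x0 e x0 * v 0 l.
Proof.
have dc : differentiable (fun x => x 0 l - x0 0 l : R) x0.
  by apply: (Cinf_onB_cst l (x0 0 l) openT 1%N).1.
have db : differentiable (bump x0 e) x0 by exact: (bump_smooth x0 e 1%N).1.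
rewrite [LHS](deriveM (diff_derivable db) (diff_derivable dc)).
rewrite subrr scale0r addr0.
rewrite deriveB; [|exact/diff_derivable/differentiable_coord|exact: derivable_cst].
by rewrite derive_coord derive_cst subr0.
Qed.

End BumpEuclidean.

(** * Global smooth functions separate tangent vectors *)

Section BumpManifold.
Variables (R : realType) (n : nat) (M : manifold R n).

Definition chart_extend (i : chart_idx M) (g : 'rV[R]_n -> R) (p : M) : R :=
  if `[< chart_dom i p >] then g (chart i p) else 0.

Lemma chart_extendE i g p : chart_dom i p -> chart_extend i g p = g (chart i p).
Proof. by move=> ip; rewrite /chart_extend asboolT. Qed.

(** M is the union of two open sets on which smoothness is clear: the chart
    domain, and the complement of the image of K, on which the function is 0.
    The latter is open because a compact subset of a Hausdorff space is
    closed. *)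
Lemma chart_extend_smooth i g (K : set 'rV[R]_n) : compact K ->
  K `<=` chart i @` chart_dom i -> (forall x, ~ K x -> g x = 0) ->
  Cinf_on setT g -> smooth_on setT (chart_extend i g).
Proof.
move=> cK Ki g0 Hg.
have oi := @chart_dom_open _ _ M i.
have clK : closed (@chart_inv _ _ M i @` K).
  apply: compact_closed (manifold_hausdorff (m:=M)) _.
  apply: continuous_compact cK; apply: continuous_in_subspaceT => x.
  by rewrite inE => /Ki[p ip <-]; exact: chart_inv_continuous.
apply: smooth_on_local => [|p _]; first exact: openT.
have [ip|nip] := pselect (chart_dom i p).
  exists (chart_dom i) => //; rewrite setTI.
  have H : smooth_on (chart_dom i `&` setT) (g \o @chart _ _ M i).
    by apply: smooth_on_chart => [|k]; [exact: openT|exact: Ck_onW (Hg k)].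
  rewrite setIT in H; apply: (smooth_on_eq oi _ H) => q iq.
  by rewrite chart_extendE.
have oC := closed_openC clK.
exists (~` (@chart_inv _ _ M i @` K)).
  split=> // -[x /Ki[q iq <-] e]; apply: nip; by rewrite -e chartK.
rewrite setTI; apply: (smooth_on_eq oC _ (smooth_on_cst _ 0)) => q nq.
rewrite /chart_extend; case: asboolP => // iq; rewrite g0 // => Kq.
by apply: nq; exists (chart i q); rewrite ?chartK.
Qed.

(** The l-th coordinate of v in a chart is, up to a positive factor, the
    derivative along v of the extended l-th bump coordinate. *)
Lemma tangent_act_eq0 p (v : tangent_bundle M p) :
  (forall f : smooth_function M, tangent_act v f = 0) -> v = 0.
Proof.
move=> v0; have [i ip] := chart_cover p.
suff t0 : tangent_triv i p v = 0.
  by apply: (bij_inj (tangent_triv_bij ip)); rewrite t0 linear0.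
have nU : nbhs (chart i p) (chart i @` chart_dom i).
  by apply: open_nbhs_nbhs; split; [exact: chart_cod_open|exists p].
have [e e0 eU] := box_nbhs nU.
apply/rowP => l; rewrite mxE.
have Hf : smooth_on setT (chart_extend i (bump_coord (chart i p) e l)).
  apply: (chart_extend_smooth (@box_compact R n (chart i p) e) eU) => [x nx|]; last first.
    exact: bump_coord_smooth.
  by rewrite /bump_coord bump_out ?mul0r.
have := v0 (SmoothFunction Hf).
rewrite (tangent_act_chart v Hf ip).
have nE : \forall x \near chart i p,
    (chart_extend i (bump_coord (chart i p) e l) \o chart_inv i) x =
    bump_coord (chart i p) e l x.
  by apply: filterS nU => _ [q iq <-]; rewrite /= chartK // chart_extendE.
rewrite (near_eq_derive _ nE) derive_bump_coord => /eqP.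
by rewrite mulf_eq0 gt_eqF ?bump_center //= => /eqP.
Qed.

End BumpManifold.

(** * Bilinear operations and Lie brackets *)

Section Bilinear.
Variables (R : realType) (V : lmodType R) (op : V -> V -> V).
Hypothesis bop : is_bilinear op.

Lemma bilinearDr u v w : op u (v + w) = op u v + op u w.
Proof. by have := bop.1 u 1 v w; rewrite !scale1r. Qed.

Lemma bilinearDl u v w : op (u + v) w = op u w + op v w.
Proof. by have := bop.2 w 1 u v; rewrite !scale1r. Qed.

Lemma bilinear0r u : op u 0 = 0.
Proof. by apply: (addrI (op u 0)); rewrite -bilinearDr !addr0. Qed.

Lemma bilinear0l v : op 0 v = 0.
Proof. by apply: (addrI (op 0 v)); rewrite -bilinearDl !addr0. Qed.

Lemma bilinearNr u v : op u (- v) = - op u v.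
Proof. by apply: (addrI (op u v)); rewrite -bilinearDr !subrr bilinear0r. Qed.

Lemma bilinearNl u v : op (- u) v = - op u v.
Proof. by apply: (addrI (op u v)); rewrite -bilinearDl !subrr bilinear0l. Qed.

End Bilinear.

Section LieBracket.
Variables (R : realType) (V : lmodType R) (br : V -> V -> V).
Hypothesis brP : is_lie_bracket br.

Lemma lie_antisym u v : br v u = - br u v.
Proof.
have b := lie_bilinear brP; apply/eqP; rewrite -addr_eq0 addrC; apply/eqP.
have := lie_alternating brP (u + v).
by rewrite (bilinearDl b) !(bilinearDr b) !(lie_alternating brP) add0r addr0.
Qed.

Lemma lie_derivation u v w : br u (br v w) = br (br u v) w + br v (br u w).
Proof.
have b := lie_bilinear brP; have := lie_jacobi brP u v w.
rewrite (lie_antisym u w) (lie_antisym (br u v) w) (bilinearNr b).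
by move/eqP; rewrite -addrA -opprD subr_eq0 addrC => /eqP.
Qed.

End LieBracket.

(** * Operations on sections *)

Section SectionMaps.
Variables (R : realType) (n : nat) (M : manifold R n).

Lemma section_fscaleD r (E : vector_bundle M r) (f : smooth_function M) (u v : section E) :
  section_fscale f (u + v) = section_fscale f u + section_fscale f v.
Proof. by apply: section_eq => p /=; rewrite scalerDr. Qed.

Lemma section_fscaleN r (E : vector_bundle M r) (f : smooth_function M) (u : section E) :
  section_fscale f (- u) = - section_fscale f u.
Proof. by apply: section_eq => p /=; rewrite scalerA mulrC -scalerA. Qed.

Lemma section_fscale0 r (E : vector_bundle M r) (f : smooth_function M) (u : section E) :
  (forall p, f p = 0) -> section_fscale f u = 0.
Proof. by move=> f0; apply: section_eq => p /=; rewrite f0 scale0r. Qed.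

Variables (r s : nat) (E : vector_bundle M r) (F : vector_bundle M s).
Variable h : bundle_hom E F.
Local Notation hS := (bundle_hom_section h).

Lemma bundle_hom_section_linear : linear hS.
Proof. by move=> c u v; apply: section_eq => p /=; rewrite linearP. Qed.

HB.instance Definition _ :=
  GRing.isLinear.Build R (section E) (section F) _ hS bundle_hom_section_linear.

Lemma bundle_hom_section_fscale f u : hS (section_fscale f u) = section_fscale f (hS u).
Proof. by apply: section_eq => p /=; rewrite linearZ. Qed.

Lemma bundle_hom_section_comp t (G : vector_bundle M t) (g : bundle_hom F G) u :
  bundle_hom_section (bundle_hom_comp g h) u = bundle_hom_section g (hS u).
Proof. by apply: section_eq => p /=; rewrite comp_lfunE. Qed.

End SectionMaps.

Section VectorFields.
Variables (R : realType) (n : nat) (M : manifold R n).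
Implicit Types (f : M -> R).

Lemma tangent_act0 p f : tangent_act (0 : tangent_bundle M p) f = 0.
Proof. exact: derive0. Qed.

Lemma tangent_act_cst p (v : tangent_bundle M p) (c : R) : tangent_act v (fun=> c) = 0.
Proof. exact: derive_cst. Qed.

End VectorFields.

(** * The anchor kernel is an ideal *)

Section LieAlgebroid.
Variables (R : realType) (n : nat) (M : manifold R n) (r : nat) (A : lie_algebroid M r).
Implicit Types (x y z : section A) (f : smooth_function M).
Local Notation br := (@lie_bracket _ _ _ _ A).
Local Notation act x f := (vector_field_act (bundle_hom_section (lie_anchor A) x) f).

(** The anchor preserves brackets, in the only form accessible to Jacobi and
    Leibniz: as derivations multiplying a section z.  Both sides come from
    expanding [[x, y], f z] = [x, [y, f z]] - [y, [x, f z]], in which the mixed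
    terms (x f) [y, z] and (y f) [x, z] cancel. *)
Lemma anchor_bracket_act x y z f :
  section_fscale (act (br x y) f) z =
  section_fscale (act x (act y f)) z - section_fscale (act y (act x f)) z.
Proof.
have brP := @lie_bracketP _ _ _ _ A; have bb := lie_bilinear brP.
have e1 : br (br x y) (section_fscale f z) =
    br x (br y (section_fscale f z)) - br y (br x (section_fscale f z)).
  by rewrite (lie_derivation brP x y) addrK.
have e2 : section_fscale f (br (br x y) z) =
    section_fscale f (br x (br y z)) - section_fscale f (br y (br x z)).
  by rewrite (lie_derivation brP x y) section_fscaleD addrK.
move: e1; rewrite !lie_leibniz !(bilinearDr bb) !lie_leibniz e2.
set a := section_fscale f _; set b := section_fscale f _.
move=> e; apply: (addrI (a - b)); rewrite e.
set c := section_fscale _ (br y z); set d := section_fscale _ (br x z).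
rewrite (addrACA b d c) opprD addrACA.
by congr (_ + _); rewrite opprD addrACA subrr ?addr0 ?add0r.
Qed.

Lemma lie_leibnizl x y f :
  br (section_fscale f x) y =
  section_fscale f (br x y) - section_fscale (act y f) x.
Proof.
have brP := @lie_bracketP _ _ _ _ A.
rewrite (lie_antisym brP y) lie_leibniz opprD.
by rewrite (lie_antisym brP x y) section_fscaleN opprK.
Qed.

Lemma anchor_act0 x f : (forall p, lie_anchor A p (x p) = 0) ->
  forall p, act x f p = 0.
Proof. by move=> x0 p /=; rewrite x0 tangent_act0. Qed.

(** In anchor_bracket_act take z = [x, y]: at a point where [x, y] vanishes so
    does its anchor, and elsewhere z can be cancelled. *)
Lemma bracket_anchor_ker x y : (forall p, lie_anchor A p (y p) = 0) ->
  forall p, lie_anchor A p (br x y p) = 0.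
Proof.
move=> y0 p; apply: tangent_act_eq0 => f.
have H : section_fscale (act (br x y) f) (br x y) = 0.
  rewrite anchor_bracket_act (section_fscale0 _ (anchor_act0 (act x f) y0)) subr0.
  apply: section_fscale0 => q /=.
  rewrite (_ : (fun q => _) = fun=> 0) ?tangent_act_cst //.
  by apply/funext => q'; rewrite y0 tangent_act0.
have := congr1 (fun u : section A => u p) H; rewrite /= => /eqP.
rewrite scaler_eq0 => /orP[/eqP //|/eqP ->].
by rewrite linear0 tangent_act0.
Qed.

End LieAlgebroid.

(** * The post-Lie structure *)

Theorem theorem4p13 (R : realType) (n : nat) (M : manifold R n) (r : nat)
    (A : rota_baxter_lie_algebroid M r) :
  let K := anchor_kernel (rb_transitive A) in
  let i := anchor_kernel_incl (tA := rb_transitive A) in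
  let B := rb_operator A in
  exists br rhd : section K -> section K -> section K,
    [/\ forall u v, i (br u v) = lie_bracket (i u) (i v),
        forall u v, i (rhd u v) = lie_bracket (bundle_hom_section B u) (i v)
      & is_post_lie_algebroid br rhd (bundle_hom_comp (lie_anchor A) B)].
Proof.
move=> K i B; set b := bundle_hom_section B.
have iK u p : lie_anchor A p (i u p) = 0.
  by move: p; apply/(kernel_inclP (rb_transitive A)); exists u.
have lift x u : {w | i w = lie_bracket x (i u)}.
  by apply: cid; apply/(kernel_inclP (rb_transitive A)); exact/bracket_anchor_ker/iK.
pose br u v := sval (lift (i u) v); pose rhd u v := sval (lift (b u) v).
have brE u v : i (br u v) = lie_bracket (i u) (i v) := svalP (lift (i u) v).
have rhdE u v : i (rhd u v) = lie_bracket (b u) (i v) := svalP (lift (b u) v).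
have inj u v : i u = i v -> u = v := @kernel_incl_inj _ _ _ _ _ _ _ _ _ u v.
have iD u v : i (u + v) = i u + i v by exact: linearD.
have iN u : i (- u) = - i u by exact: linearN.
have i0 : i 0 = 0 by exact: linear0.
have iZ c u : i (c *: u) = c *: i u by exact: linearZ.
have iF f u : i (section_fscale f u) = section_fscale f (i u).
  exact: bundle_hom_section_fscale.
have bf f u : b (section_fscale f u) = section_fscale f (b u).
  exact: bundle_hom_section_fscale.
have LP := @lie_bracketP _ _ _ _ A; have LB := lie_bilinear LP.
exists br, rhd; split=> //; split.
- move=> f u v; apply: inj; rewrite brE !iF brE lie_leibnizl.
  by rewrite (section_fscale0 _ (anchor_act0 f (iK v))) subr0.
- move=> f u v; apply: inj; rewrite brE !iF brE lie_leibniz.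
  by rewrite (section_fscale0 _ (anchor_act0 f (iK u))) addr0.
- split.
  + split.
    * split=> [u c v w|v c u w]; apply: inj; rewrite iD iZ !brE iD iZ.
        exact: LB.1.
      exact: LB.2.
    * by move=> u; apply: inj; rewrite brE i0; exact: lie_alternating.
    * by move=> u v w; apply: inj; rewrite !iD !brE i0; exact: lie_jacobi.
  + split=> [u c v w|v c u w]; apply: inj; rewrite iD iZ !rhdE.
      by rewrite iD iZ; exact: LB.1.
    by rewrite /b linearD linearZ; exact: LB.2.
  + by move=> u v w; apply: inj; rewrite iD !brE !rhdE !brE; exact: lie_derivation.
  + (* The Rota-Baxter identity expresses B [u, v]; its middle term B [u, B v]
       is - B (v |> u). *)
    move=> u v w; apply: inj; rewrite /associator !iD !iN !iD !iN !rhdE.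
    have u_Bv : i (- rhd v u) = lie_bracket (i u) (b v).
      by rewrite iN rhdE -(lie_antisym LP).
    have := rb_operatorP (rhdE u v) u_Bv (brE u v).
    rewrite scale1r -/b => RB.
    have -> : b (br u v) = lie_bracket (b u) (b v) - b (rhd u v) + b (rhd v u).
      have bN : b (- rhd v u) = - b (rhd v u) by exact: linearN.
      rewrite RB bN.
      by rewrite -(addrA (b _)) (addrC (b (rhd u v))) addrK addrAC addNr add0r.
    rewrite !(bilinearDl LB) (bilinearNl LB) (lie_derivation LP (b u)).
    by rewrite opprB (addrAC _ _ (- _)) -[RHS]addrA (addrC (lie_bracket (b v) _)) subrK.
- move=> f u v; apply: inj; rewrite iD !rhdE !iF rhdE lie_leibniz.
  congr (_ + section_fscale _ _).
  by rewrite bundle_hom_section_comp.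
- move=> f u v; apply: inj; rewrite rhdE !iF bf rhdE lie_leibnizl.
  by rewrite (section_fscale0 _ (anchor_act0 f (iK v))) subr0.
Qed.
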